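(* Let $X$ be a $2$-dimensional simplicial complex on $n$ vertices with complete $1$-skeleton, and let $\lambda^1(X)$ be the spectral gap of the (up-down) Laplacian acting on $1$-cochains of $X$. Let $\phi:X\to\mathcal H$ be an affine map into a Hilbert space $\mathcal H$, scaled so that $$\mathrm{Fill}_{\mathcal H}(\phi\tau)\ \ge\ \mathrm{Fill}_X(\tau)$$ for every $1$-cycle $\tau$ of length $3$ in $X$. Then $$\sum_{f\in X^{(2)}}\big(\mathrm{Area}(\phi f)\big)^2\ \ge\ \frac{\lambda^1(X)}{3(n-2)}\sum_{\tau}\big(\mathrm{Fill}_X(\tau)\big)^2,$$ where the first sum runs over the $2$-dimensional faces of $X$ and the second sum runs over all $1$-cycles $\tau$ of length $3$ in $X$ (i.e. all $\binom n3$ triangles formed by three edges, whether or not they bound a face of $X$).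
   Context: $X^{(k)}$ is the set of $k$-dimensional faces of $X$. A map $\phi:X\to\mathcal H$ is affine if it is affine on each simplex. $\mathrm{Area}(\phi f)$ is the Euclidean area of the (possibly degenerate) triangle $\phi(f)$. Spectral gap: $C^k_{\mathbb R}X$ is the space of real simplicial $k$-cochains (after fixing orientations of the simplices), with norm $\|\beta\|=\big(\sum_{x\in X^{(k)}}|\beta(x)|^2\big)^{1/2}$; $d: C^{k-1}_{\mathbb R}X\to C^{k}_{\mathbb R}X$ is the coboundary map, $d\beta(y)=\sum_{x\in\partial y}\beta(x)$ (signs according to orientation), and $\partial=d^*: C^k_{\mathbb R}X\to C^{k-1}_{\mathbb R}X$ is its adjoint. The spectral gap of the up-down Laplacian $d^*d$ on $1$-cochains is $$\lambda^1(X)=\inf_{\beta\in C^1_{\mathbb R}X,\ \beta\neq0,\ \partial\beta=0}\frac{\|d\beta\|^2}{\|\beta\|^2}.$$ Fillings: $C_kX$ denotes simplicial $k$-chains with $\mathbb{Z}_2$-coefficients, and $\|y\|$ is the number of non-zero coefficients of $y\in C_kX$. For a $1$-cycle $z$ in $C_1X$, $\mathrm{Fill}_X(z)=\min\{\|y\|: y\in C_2X,\ \partial y=z\}$ (equal to $+\infty$ if $z$ is not a boundary). For a $\mathbb{Z}_2$ Lipschitz $1$-cycle $w$ in $\mathcal H$, $\mathrm{Fill}_{\mathcal H}(w)=\inf\{\mathrm{vol}_2(y)\}$ over $\mathbb{Z}_2$ Lipschitz $2$-chains $y$ in $\mathcal H$ (finite formal $\mathbb Z_2$-sums of Lipschitz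 maps of the standard $2$-simplex) with $\partial y=w$, where $\mathrm{vol}_2$ is total area. $\phi\tau$ is the image of the cycle $\tau$ under $\phi$; for $\tau$ of length $3$, this is the boundary of a (possibly degenerate) Euclidean triangle. *)

(* Defs.v *)
From HB Require Import structures.
From mathcomp Require Import all_boot all_order all_algebra.
From mathcomp Require Import sesquilinear.
From mathcomp Require Import all_classical all_reals all_analysis.
From mathcomp Require Import freeg.

Set Implicit Arguments.
Unset Strict Implicit.
Unset Printing Implicit Defensive.

Import Order.TTheory GRing.Theory Num.Theory.
Import numFieldNormedType.Exports.

Local Open Scope ring_scope.

Definition simplicial_complex (n : nat) (X : {set {set 'I_n}}) : Prop :=
  [/\ forall v : 'I_n, [set v] \in X,
      finset.set0 \notin X
    & forall s t : {set 'I_n},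
        s \in X -> t \subset s -> t != finset.set0 -> t \in X].

Definition dimension_is (n : nat) (X : {set {set 'I_n}}) (k : nat) : Prop :=
  (forall s, s \in X -> (#|s| <= k.+1)%N) /\ (exists2 s, s \in X & #|s| = k.+1).

Definition complete_1skeleton (n : nat) (X : {set {set 'I_n}}) : Prop :=
  forall u v : 'I_n, u != v -> [set u; v] \in X.

Definition face (n : nat) (X : {set {set 'I_n}}) (k : nat) : Type :=
  {s : {set 'I_n} | (s \in X) && (#|s| == k.+1)}.

HB.instance Definition _ n (X : {set {set 'I_n}}) k :=
  SubFinite.on (face X k).

(** Chains and cochains with coefficients in [K] are both functions on
    [face X k]: each face carries the orientation given by the increasing order
    of its vertices. *)

Definition chain (K : Type) (n : nat) (X : {set {set 'I_n}}) (k : nat) : Type :=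
  {ffun face X k -> K}.

(* The index of [v] in the increasing enumeration of the vertices of [s]. *)
Definition position (n : nat) (s : {set 'I_n}) (v : 'I_n) : nat :=
  #|[set u in s | (u < v)%N]|.

(* At most one [v] contributes: the vertex opposite to [x] in [y]. *)
Definition incidence (K : nzRingType) (n : nat) (x y : {set 'I_n}) : K :=
  \sum_(v in y | x == (y :\ v)) (-1) ^+ position y v.

Section Chains.
Context {K : nzRingType} {n : nat} {X : {set {set 'I_n}}} {k : nat}.

HB.instance Definition _ := GRing.Zmodule.on (chain K X k).

Definition coboundary (b : chain K X k) : chain K X k.+1 :=
  [ffun y => \sum_(x : face X k) incidence K (val x) (val y) * b x].

Definition boundary (c : chain K X k.+1) : chain K X k :=
  [ffun x => \sum_(y : face X k.+1) incidence K (val x) (val y) * c y].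

Definition card_supp (c : chain K X k) : nat := #|[set x | c x != 0]|.
End Chains.

HB.instance Definition _ (K : finNzRingType) n (X : {set {set 'I_n}}) k :=
  Finite.on (chain K X k).

Lemma boundary_adjoint (K : comNzRingType) n (X : {set {set 'I_n}}) k
    (b : chain K X k) (c : chain K X k.+1) :
  \sum_y coboundary b y * c y = \sum_x b x * boundary c x.
Proof.
under eq_bigr do rewrite ffunE mulr_suml.
under [RHS]eq_bigr do rewrite ffunE mulr_sumr.
rewrite exchange_big /=; apply: eq_bigr => x _; apply: eq_bigr => y _.
by rewrite mulrA [b x * _]mulrC.
Qed.

Section SpectralGap.
Context (R : realType) (n : nat) (X : {set {set 'I_n}}).

Definition cochain_norm (k : nat) (b : chain R X k) : R :=
  Num.sqrt (\sum_x `|b x| ^+ 2).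

Definition spectral_gap1 : \bar R :=
  ereal_inf [set (cochain_norm (coboundary b) ^+ 2 / cochain_norm b ^+ 2)%:E
            | b in [set b : chain R X 1 | b != 0 /\ boundary b = 0]]%classic.

(* [\min] over a finite type, with value [+oo] when [z] is not a boundary *)
Definition fill_simplicial (z : chain 'F_2 X 1) : \bar R :=
  \big[Order.min/+oo%E]_(y : chain 'F_2 X 2 | boundary y == z)
     (card_supp y)%:R%:E.
End SpectralGap.

Definition std_simplex (R : realType) (k : nat) : Type :=
  {t : 'rV[R]_k.+1 | [forall i, 0 <= t 0 i] && (\sum_i t 0 i == 1)}.

HB.instance Definition _ R k := SubChoice.on (std_simplex R k).

Definition face_row (R : realType) (k : nat) (i : 'I_k.+2) (t : 'rV[R]_k.+1) :
    'rV[R]_k.+2 :=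
  \row_j (if unlift i j is Some j' then t 0 j' else 0).

Lemma face_row_std (R : realType) k (i : 'I_k.+2) (t : std_simplex R k) :
  [forall j, 0 <= face_row i (val t) 0 j] &&
  (\sum_j face_row i (val t) 0 j == 1).
Proof.
case: t => t /= /andP[/forallP t0 /eqP t1]; apply/andP; split.
  by apply/forallP => j; rewrite mxE; case: unliftP.
rewrite (bigD1_ord i) //= mxE unlift_none add0r -t1; apply/eqP.
by apply: eq_bigr => j _; rewrite mxE liftK.
Qed.

Definition face_incl (R : realType) (k : nat) (i : 'I_k.+2)
    (t : std_simplex R k) : std_simplex R k.+1 :=
  exist _ (face_row i (val t)) (face_row_std i t).

Section LipschitzChains.
Context {R : realType} {H : completeNormedModType R}.

Definition singular (k : nat) : Type := std_simplex R k -> H.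

HB.instance Definition _ k := Choice.on (singular k).

Definition singular_chain (k : nat) : Type := {freeg (singular k) / 'F_2}.

HB.instance Definition _ k := GRing.Zmodule.on (singular_chain k).

Definition lipschitz_simplex (k : nat) (s : singular k) : Prop :=
  exists L : R, forall t u, `|s t - s u| <= L * `|val t - val u|.

Definition lipschitz_chain (k : nat) (c : singular_chain k) : Prop :=
  forall s, s \in dom c -> lipschitz_simplex s.

Definition singular_boundary (k : nat) (c : singular_chain k.+1) :
    singular_chain k :=
  \sum_(s <- dom c) \sum_(i < k.+2) << coeff s c *g ((fun t => s (face_incl i t)) : singular k) >>.

(* square root of the Gram determinant *)
Definition parallelogram_area (dot : {dot H for idfun}) (u v : H) : R :=
  Num.sqrt (dot u u * dot v v - dot u v ^+ 2).

Definition triangle_area (dot : {dot H for idfun}) (p q r : H) : R :=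
  parallelogram_area dot (q - p) (r - p) / 2.

(* [s] in the coordinates [(a, b) |-> (1 - a - b, a, b)] on the simplex,
   extended by [0] *)
Definition in_coordinates (s : singular 2) (a b : R) : H :=
  oapp s 0 (insub (\row_(i < 3) [:: 1 - a - b; a; b]`_i)).

(* By Rademacher's theorem a Lipschitz [s] is differentiable almost everywhere,
   and its area is the integral of its Jacobian; the extension by [0] above
   only matters on the boundary of the domain, a null set. *)
Definition singular_area (dot : {dot H for idfun}) (s : singular 2) : \bar R :=
  (\int[(@lebesgue_measure R \x @lebesgue_measure R)%E]_(x in
      [set x : R * R | [/\ 0 <= x.1, 0 <= x.2 & x.1 + x.2 <= 1]%R]%classic)
    (parallelogram_area dot
       (derive1 (fun a => in_coordinates s a x.2) x.1)
       (derive1 (fun b => in_coordinates s x.1 b) x.2))%:E)%E.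

Definition vol2 (dot : {dot H for idfun}) (c : singular_chain 2) : \bar R :=
  (\sum_(s <- dom c) singular_area dot s)%E.

Definition fill_lipschitz (dot : {dot H for idfun}) (w : singular_chain 1) :
    \bar R :=
  ereal_inf [set vol2 dot y
            | y in [set y | lipschitz_chain y /\ singular_boundary y = w]]%classic.
End LipschitzChains.

(* Points of the geometric realization are given by their barycentric coordinates. *)
Definition closed_simplex (R : realType) (n : nat) (s : {set 'I_n}) :
    set 'rV[R]_n :=
  [set x : 'rV[R]_n | [/\ forall i, 0 <= x 0 i, \sum_i x 0 i = 1
             & forall i, i \notin s -> x 0 i = 0]]%classic.

(* Only the values of [phi] on the realization of [X] are relevant. *)
Definition affine_on (R : realType) (H : completeNormedModType R) (n : nat)
    (X : {set {set 'I_n}}) (phi : 'rV[R]_n -> H) : Prop :=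
  forall s, s \in X -> forall x y : 'rV[R]_n,
    closed_simplex s x -> closed_simplex s y ->
  forall t : R, 0 <= t <= 1 ->
    phi ((1 - t) *: x + t *: y) = (1 - t) *: phi x + t *: phi y.

(* The affine parametrization of the simplex [s], of dimension [k], by the
   standard one, sending vertices to vertices in increasing order. *)
Definition parametrization (R : realType) (n k : nat) (s : {set 'I_n})
    (t : 'rV[R]_k.+1) : 'rV[R]_n :=
  \row_v (if v \in s then t 0 (inord (position s v)) else 0).

Section AffineImages.
Context {R : realType} {H : completeNormedModType R}.
Context {n : nat} {X : {set {set 'I_n}}} (phi : 'rV[R]_n -> H).

Definition image_chain (k : nat) (c : chain 'F_2 X k) : singular_chain k :=
  \sum_(x : face X k)
    << c x *g ((fun t => phi (parametrization (val x) (val t))) : singular k) >>.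

Definition image_vertex (f : face X 2) (i : 'I_3) : H :=
  phi (parametrization (val f) (delta_mx 0 i : 'rV[R]_3)).

Definition image_area (dot : {dot H for idfun}) (f : face X 2) : R :=
  triangle_area dot (image_vertex f 0) (image_vertex f 1) (image_vertex f 2).
End AffineImages.

(* Main.v *)
Require Import Defs.
From mathcomp Require Import all_boot all_order all_algebra.
From mathcomp Require Import sesquilinear.
From mathcomp Require Import all_classical all_reals all_analysis.
From mathcomp Require Import measurable_realfun freeg ring lra zify.

Import Order.TTheory GRing.Theory Num.Theory.
Import numFieldNormedType.Exports.

Local Open Scope ring_scope.

(* Write p_i for the image of the vertex i. The square of twice the area of the
   triangle p_i p_j p_k is the squared norm of dB(ijk), where B(ij) is the
   bivector p_i /\ p_j; in Gram-Schmidt coordinates its components are real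
   1-cochains B_ab. Because the 1-skeleton is complete, the coclosed part B' of
   such a cochain is explicit, and dB' = dB on every triangle, face or not.
   By Cauchy-Schwarz the sum of dB'^2 over all triangles is at most
   3 (n - 2) |B'|^2, every edge lying in n - 2 triangles, while the spectral gap
   bounds |B'|^2 by the sum of dB^2 over the faces. Finally Fill_X(tau) is at
   most the area of phi tau, since the affine triangle fills phi tau. *)

(** * The parameter triangle in the plane and integrals over it *)

Section PlaneTriangle.
Context {R : realType}.
Local Notation mu := (@lebesgue_measure R).
Local Notation mu2 := (mu \x mu)%E.
Local Notation TR := (measurableTypeR R).

Definition plane_triangle : set (R * R) :=
  [set x : R * R | [/\ 0 <= x.1, 0 <= x.2 & x.1 + x.2 <= 1]%R]%classic.

Lemma measurable_plane_triangle : measurable (plane_triangle : set (TR * TR)).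
Proof.
have -> : plane_triangle = ([set x : TR * TR | 0 <= x.1 :> R] `&` [set x : TR * TR | 0 <= x.2 :> R]
   `&` [set x : TR * TR | x.1 + x.2 <= 1 :> R])%classic.
  by apply/seteqP; split => x /=; [case|case=> -[]].
have mle (f g : TR * TR -> R) : measurable_fun setT f -> measurable_fun setT g ->
    measurable [set x | f x <= g x]%classic.
  move=> mf mg; rewrite -[X in measurable X]setTI.
  exact: (@measurable_fun_le _ _ _ setT f g).
apply: measurableI; first apply: measurableI; apply: mle => //.
  by apply: measurable_funD.
Qed.

(** The section over [a] in [0, 1] is the interval [0, 1 - a], so the area is the integral of 1 - a,
    with antiderivative a - a^2 / 2. *)
Lemma plane_triangle_area : mu2 plane_triangle = (2^-1)%R%:E.
Proof.
rewrite /product_measure1.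
have sec (a : R) : mu (xsection plane_triangle a) =
    if 0 <= a <= 1 then (1 - a)%:E else 0%E.
  have [/andP[a0 a1]|a01] := boolP (0 <= a <= 1).
    have -> : xsection plane_triangle a = `[0, 1 - a]%classic.
      apply/seteqP; split => b; rewrite /xsection /= in_itv /= inE /plane_triangle /=.
        by case=> _ -> ab /=; rewrite lerBrDl.
      by move=> /andP[b0 ba]; split=> //; rewrite -lerBrDl.
    rewrite lebesgue_measure_itv /= lte_fin; case: ifPn => [_|].
      by rewrite oppr0 adde0.
    by rewrite -leNgt => h; congr (_%:E); apply/eqP; rewrite eq_le h subr_ge0 a1.
  rewrite (_ : xsection _ _ = set0) ?measure0//.
  apply/seteqP; split => b //; rewrite /xsection /= inE /plane_triangle /=.
  case=> a0 b0 ab; move/negP: a01; apply; rewrite a0 /=.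
  by apply: le_trans ab; rewrite lerDl.
transitivity (\int[mu]_(a in `[0%R, 1%R]) (1 - a)%:E)%E.
  rewrite [RHS]integral_mkcond; apply: eq_integral => a _ /=.
  by rewrite /patch mem_setE in_itv /=; exact: sec.
rewrite (@continuous_FTC2 _ _ (fun a : R => a - 2^-1 * a ^+ 2)) //.
- by rewrite -EFinB; congr (_%:E); lra.
- apply: continuous_subspaceT => x.
  by apply: cvgB; [exact: cvg_cst|exact: cvg_id].
- have c : continuous (fun a : R => a - 2^-1 * a ^+ 2).
    move=> x; apply: cvgB; first exact: cvg_id.
    by apply: cvgM; [exact: cvg_cst|exact: exprn_continuous].
  split.
  + by move=> x _.
  + exact/cvg_at_right_filter/c.
  + exact/cvg_at_left_filter/c.
- move=> x _; rewrite derive1E derive_val.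
  by rewrite /GRing.scale /=; lra.
Qed.

(** The three sides lie on lines, which are null sets. This is what lets a pointwise bound on the
    open triangle control an integral over the closed one. *)
Lemma plane_triangle_boundary_negligible :
  mu2.-negligible ((plane_triangle : set (TR * TR)) `\` [set x : R * R | [/\ 0 < x.1, 0 < x.2 & x.1 + x.2 < 1]])%classic.
Proof.
have meq (f g : TR * TR -> R) : measurable_fun setT f -> measurable_fun setT g ->
    measurable [set x | f x = g x]%classic.
  move=> mf mg; rewrite -[X in measurable X]setTI.
  have -> : [set x | f x = g x]%classic = ((fun x => f x == g x) @^-1` [set true])%classic.
    by apply/seteqP; split => x /= /eqP.
  exact: (@measurable_fun_eqr _ _ _ setT f g).
apply: (@negligibleS _ _ _ mu2
  ([set x : TR * TR | x.1 = 0 :> R] `|` [set x : TR * TR | x.2 = 0 :> R] `|` [set x : TR * TR | x.1 + x.2 = 1 :> R])%classic).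
  move=> x [] [x1 x2 x12] /= nx.
  have [->|h1] := eqVneq x.1 0; first by left; left.
  have [->|h2] := eqVneq x.2 0; first by left; right.
  have [h3|h3] := eqVneq (x.1 + x.2) 1; first by right.
  by exfalso; apply: nx; rewrite !lt_def h1 h2 x1 x2 x12 eq_sym h3.
apply: negligibleU; first apply: negligibleU; apply/negligibleP.
- exact: meq.
- rewrite /= (_ : [set x | _] = [set 0] `*` setT)%classic.
    by rewrite product_measure1E //= lebesgue_measure_set1 mul0e.
  by apply/seteqP; split=> x /=; [|case].
- exact: meq.
- rewrite /= (_ : [set x | _] = setT `*` [set 0])%classic.
    by rewrite product_measure1E //= lebesgue_measure_set1 mule0.
  by apply/seteqP; split=> x /=; [|case].
- by apply: meq => //; apply: measurable_funD.
- rewrite /= /product_measure1 integral0_eq // => a _ /=.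
  rewrite (_ : xsection _ a = [set 1 - a]%classic) ?lebesgue_measure_set1//.
  apply/seteqP; split=> b; rewrite /xsection /= inE /=.
    by move=> <-; rewrite addrC addKr.
  by move=> ->; rewrite addrC subrK.
Qed.

Import HBNNSimple.

(* The integrand is not assumed measurable: the integral of a nonnegative
   function is by definition a supremum over simple functions below it. *)
Lemma integral_plane_triangle_le (f : R * R -> R) (c : R) : 0 <= c ->
  (forall x, 0 <= f x) ->
  (forall x, 0 < x.1 -> 0 < x.2 -> x.1 + x.2 < 1 -> f x <= c) ->
  (\int[mu2]_(x in plane_triangle) (f x)%:E <= (c / 2)%:E)%E.
Proof.
move=> c0 f0 fc; rewrite ge0_integralE; last by move=> x _; rewrite lee_fin.
apply: ge_ereal_sup => _ [h /= hf <-].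
rewrite -[sintegral _ _]integralT_nnsfun.
rewrite EFinM -plane_triangle_area -(integral_cst _ measurable_plane_triangle).
rewrite [leRHS]integral_mkcond; apply: ae_ge0_le_integral => //.
- by move=> x _; rewrite lee_fin; exact: fun_ge0.
- by apply/measurable_EFinP; exact: measurable_funP.
- by move=> x _; rewrite /patch; case: ifP.
- apply/(measurable_restrictT _ _).1 => //; exact: measurable_plane_triangle.
(* A point where [h] exceeds the restricted constant [c] must lie on a side: outside the triangle
   [h] is at most 0, and in the interior [fc] applies. *)
apply: negligibleS plane_triangle_boundary_negligible => x /= nx.
have xT : plane_triangle x.
  apply: contrapT => xT; apply: nx => _.
  by have := hf x; rewrite /patch memNset.
split=> // -[x1 x2 x12]; apply: nx => _.
by apply: le_trans (hf x) _; rewrite /patch mem_set //= lee_fin fc.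
Qed.
End PlaneTriangle.

(** * Area and Lipschitz bound of an affine singular triangle *)

Section AffineSimplex.
Context {R : realType} {H : completeNormedModType R}.

Definition affine_simplex (p q r : H) : singular 2 :=
  fun t : std_simplex R 2 => val t 0 0 *: p + val t 0 1 *: q + val t 0 2 *: r.

Lemma in_coordinates_affine (p q r : H) (a b : R) : 0 <= a -> 0 <= b -> a + b <= 1 ->
  in_coordinates (affine_simplex p q r) a b = (1 - a - b) *: p + a *: q + b *: r.
Proof.
move=> a0 b0 ab; rewrite /in_coordinates; case: insubP => [t _ /= tE|].
  by rewrite /affine_simplex; move: tE; case: t => t ht /= ->; rewrite !mxE.
move=> /negP[]; apply/andP; split; last first.
  by rewrite !big_ord_recl big_ord0 !mxE /=; apply/eqP; ring.
apply/forallP => i; rewrite mxE.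
by case: i => -[|[|[]]] //= _; lra.
Qed.

Lemma derive1_line (u v : H) (x : R) : derive1 (fun a : R => u + a *: v) x = v.
Proof.
apply: lim_near_cst => //; near=> h.
rewrite opprD addrACA subrr add0r -scalerBl addrK scalerA mulVf ?scale1r//.
by near: h; exact: nbhs_dnbhs_neq.
Unshelve. all: by end_near. Qed.

Lemma near_eq_derive1 (f g : R -> H) (x e : R) : 0 < e ->
  (forall y, `|x - y| < e -> f y = g y) -> derive1 f x = derive1 g x.
Proof.
move=> e0 fg; rewrite !derive1E; apply: near_eq_derive.
by near=> y; apply: fg; near: y; exists e.
Unshelve. all: by end_near. Qed.

(** In the interior the partial derivatives are the constants [q - p] and [r - p]; the integrand is
    then the parallelogram area, and the domain has measure 1/2. *)
Lemma singular_area_affine (dot : {dot H for idfun}) (p q r : H) :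
  (singular_area dot (affine_simplex p q r) <= (triangle_area dot p q r)%:E)%E.
Proof.
apply: integral_plane_triangle_le => [|x|[a b] /= a0 b0 ab]; rewrite ?sqrtr_ge0 //.
suff [-> ->] : derive1 (fun a => in_coordinates (affine_simplex p q r) a b) a = q - p /\
  derive1 (fun b => in_coordinates (affine_simplex p q r) a b) b = r - p by [].
(* Moving one coordinate by less than [e] keeps the point in the triangle, so the default value 0 of
   [in_coordinates] does not affect the derivatives. *)
pose e := Num.min a (Num.min b (1 - a - b)).
have e0 : 0 < e by rewrite !lt_min a0 b0; lra.
have [ea eb ec] : [/\ e <= a, e <= b & e <= 1 - a - b].
  by split; rewrite !ge_min lexx ?orbT.
split.
- transitivity (derive1 (fun a => ((1 - b) *: p + b *: r) + a *: (q - p)) a).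
    apply: (@near_eq_derive1 _ _ _ e) => // y; rewrite ltr_distl => /andP[y1 y2].
    rewrite in_coordinates_affine; [|lra..].
    rewrite scalerBr !scalerBl scale1r -!addrA; congr (_ + _).
    rewrite addrCA; congr (_ + _); rewrite addrCA [RHS]addrC -addrA addrC.
    by rewrite -!addrA.
  by rewrite derive1_line.
- transitivity (derive1 (fun b => ((1 - a) *: p + a *: q) + b *: (r - p)) b).
    apply: (@near_eq_derive1 _ _ _ e) => // y; rewrite ltr_distl => /andP[y1 y2].
    rewrite in_coordinates_affine; [|lra..].
    rewrite scalerBr [(1 - a - y) *: p]scalerBl -!addrA; congr (_ + _).
    by rewrite addrC -!addrA.
  by rewrite derive1_line.
Qed.

(** The norm of a row vector is its largest entry in absolute value, so each barycentric coordinate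
    is 1-Lipschitz and the norms of the three vertices add up. *)
Lemma lipschitz_affine_simplex (p q r : H) : lipschitz_simplex (affine_simplex p q r).
Proof.
exists (`|p| + `|q| + `|r|) => t u; rewrite /affine_simplex.
have -> : forall a b c a' b' c' : R, a *: p + b *: q + c *: r - (a' *: p + b' *: q + c' *: r)
   = (a - a') *: p + (b - b') *: q + (c - c') *: r.
  by move=> a b c a' b' c'; rewrite !scalerBl !opprD [LHS]addrACA [in LHS](addrACA (a *: p)).
have le i : `|val t 0 i - val u 0 i| <= `|val t - val u|.
  have -> : val t 0 i - val u 0 i = (val t - val u) 0 i by rewrite !mxE.
  rewrite [leRHS]mx_normrE; exact: (@le_bigmax _ _ _ _ (fun ij => `|(val t - val u) ij.1 ij.2|) (0, i)).
rewrite !mulrDl; apply: le_trans (ler_normD _ _) _; apply: lerD.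
  apply: le_trans (ler_normD _ _) _; apply: lerD;
  by rewrite normrZ mulrC ler_wpM2l.
by rewrite normrZ mulrC ler_wpM2l.
Qed.
End AffineSimplex.

(** * Increasing enumerations and positions in sets of two or three vertices *)

Section OrderedSubsets.
Context {n : nat}.
Implicit Types (i j k v w : 'I_n) (s : {set 'I_n}).

Lemma sorted_enum_ord s : sorted (fun i j => (i < j)%N) (enum s).
Proof.
rewrite /enum_mem -enumT; apply: sorted_filter => [? ? ?|]; first exact: ltn_trans.
have := iota_ltn_sorted 0 n; rewrite -val_enum_ord sorted_map; exact.
Qed.

Lemma card2_increasing s : #|s| = 2%N -> exists i j, (i < j)%N /\ s = [set i; j].
Proof.
rewrite cardE => h; move: (sorted_enum_ord s) (set_enum s).
case: (enum s) h => [|i [|j []]] //= _ /andP[ij _] <-.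
by exists i, j; split=> //; apply/setP => x; rewrite !inE.
Qed.

Lemma card3_increasing s : #|s| = 3%N ->
  exists i j k, [/\ (i < j)%N, (j < k)%N & s = [set i; j; k]].
Proof.
rewrite cardE => h; move: (sorted_enum_ord s) (set_enum s).
case: (enum s) h => [|i [|j [|k []]]] //= _ /and3P[ij jk _] <-.
by exists i, j, k; split=> //; apply/setP => x; rewrite !inE orbA.
Qed.

Lemma position2l i j : (i < j)%N -> position [set i; j] i = 0%N.
Proof.
move=> ij; apply: eq_card0 => x; rewrite !inE.
by apply/negP => /andP[/orP[]/eqP->]; lia.
Qed.

Lemma position2r i j : (i < j)%N -> position [set i; j] j = 1%N.
Proof.
move=> ij; rewrite /position (_ : [set u in _ | _] = [set i]) ?cards1//.
by apply/setP => x; rewrite !inE; apply/andP/eqP => [[/orP[]/eqP->]|->];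
  rewrite ?eqxx//; lia.
Qed.

Lemma position2 v w : v != w -> position [set v; w] w = (v < w)%N.
Proof.
rewrite neq_ltn => /orP[] h; first by rewrite position2r// h.
by rewrite finset.setUC position2l// ltnNge ltnW.
Qed.

Lemma position3 i j k : (i < j)%N -> (j < k)%N ->
  [/\ position [set i; j; k] i = 0, position [set i; j; k] j = 1
    & position [set i; j; k] k = 2]%N.
Proof.
move=> ij jk; split.
- apply: eq_card0 => x; rewrite !inE.
  by apply/negP => /andP[/orP[/orP[]|]/eqP->]; lia.
- rewrite /position (_ : [set u in _ | _] = [set i]) ?cards1//.
  apply/setP => x; rewrite !inE; apply/andP/eqP => [[/orP[/orP[]|]/eqP->]|->];
  rewrite ?eqxx//; lia.
- rewrite /position (_ : [set u in _ | _] = [set i; j]); last first.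
    apply/setP => x; rewrite !inE; apply/andP/orP => [[/orP[/orP[]|]/eqP->]|[]/eqP->];
    rewrite ?eqxx ?orbT//; try (by [left|right]); lia.
  by rewrite cards2 neq_ltn ij.
Qed.

End OrderedSubsets.

(** * Explicit formulas for the boundary of a 1-chain and the coboundary of a 1-cochain *)

Section Extension.
Context {K : nzRingType} {n : nat} {X : {set {set 'I_n}}}.

(** Extension by zero to all vertex sets: the sum has at most one term. It allows evaluation at
    [[set v; w]] without a proof that this is a face. *)
Definition extend {k : nat} (c : chain K X k) (s : {set 'I_n}) : K :=
  \sum_(x : face X k | val x == s) c x.

Lemma extend_val {k} (c : chain K X k) (x : face X k) : extend c (val x) = c x.
Proof. by rewrite /extend (big_pred1 x). Qed.

Lemma face_exists k (s : {set 'I_n}) : s \in X -> #|s| = k.+1 ->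
  exists x : face X k, val x = s.
Proof.
move=> sX sk; have h : (s \in X) && (#|s| == k.+1) by rewrite sX sk eqxx.
by exists (Sub s h); rewrite SubK.
Qed.

Lemma face_valP k (x : face X k) : val x \in X /\ #|val x| = k.+1.
Proof. by have /andP[-> /eqP ->] := valP x. Qed.

(** An edge incident to [v] is determined by its other endpoint [w], the vertex whose removal leaves
    [v]. The sign exponent is the position of [w] in the edge, which is 1 exactly when [v < w]. *)
Lemma boundary_vertex (c : chain K X 1) (x : face X 0) (v : 'I_n) : val x = [set v] ->
  boundary c x = \sum_(w | w != v) (-1) ^+ (v < w)%N * extend c [set v; w].
Proof.
move=> xv; rewrite ffunE.
under eq_bigr do rewrite /incidence mulr_suml.
rewrite (exchange_big_dep (fun w => w != v)) /=; last first.
  move=> y w _ /andP[wy /eqP e]; apply/eqP => wv.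
  have : w \in val y :\ w by rewrite -e xv inE wv.
  by rewrite !inE eqxx.
apply: eq_bigr => w wv; rewrite mulr_sumr.
have E (y : face X 1) : (w \in val y) && (val x == val y :\ w) = (val y == [set v; w]).
  rewrite xv; apply/andP/eqP => [[wy /eqP e]|->].
    by rewrite finset.setUC e finset.setD1K.
  split; first by rewrite !inE eqxx orbT.
  rewrite finset.setUC finset.setU1K// !inE//.
rewrite (eq_bigl _ _ E); apply: eq_bigr => y /eqP ->.
by rewrite position2 // eq_sym.
Qed.

Lemma coboundary_triangle (b : chain K X 1) (y : face X 2) (i j k : 'I_n) :
  (i < j)%N -> (j < k)%N -> val y = [set i; j; k] ->
  coboundary b y = extend b [set j; k] - extend b [set i; k] + extend b [set i; j].
Proof.
move=> ij jk yE; rewrite ffunE.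
have ij' : i != j by rewrite neq_ltn ij.
have jk' : j != k by rewrite neq_ltn jk.
have ik' : i != k by rewrite neq_ltn (ltn_trans ij jk).
under eq_bigr do rewrite /incidence mulr_suml.
rewrite (exchange_big_dep (fun w => w \in val y)) /=; last by move=> x w _ /andP[].
have -> : forall f : 'I_n -> K, \sum_(v in val y) f v = f i + f j + f k.
  move=> f; rewrite yE -finset.setUA !big_setU1 ?inE ?negb_or ?ij' ?ik' ?jk'//=.
  by rewrite finset.big_set1 addrA.
have E v : v \in val y -> \sum_(x : face X 1 | (v \in val y) && (val x == val y :\ v))
    (-1) ^+ position (val y) v * b x = (-1) ^+ position (val y) v * extend b (val y :\ v).
  by move=> vy; rewrite vy -mulr_sumr.
have [pi pj pk] := position3 _ _ _ ij jk.
rewrite !E; try by rewrite yE !inE eqxx ?orbT.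
rewrite yE pi pj pk expr0 expr1 sqrrN expr1n !mul1r mulN1r.
congr (extend b _ - extend b _ + extend b _); apply/setP => x; rewrite !inE.
- have [->|_] /= := eqVneq x i; last by rewrite ?orbA.
  by rewrite (negPf ij') (negPf ik').
- have [->|_] /= := eqVneq x j; last by rewrite ?orbF.
  by rewrite eq_sym (negPf ij') (negPf jk').
- have [->|_] /= := eqVneq x k; last by rewrite ?orbF.
  by rewrite ![k == _]eq_sym (negPf ik') (negPf jk').
Qed.
End Extension.

(** * Cycles of length 3 are triangles *)

Section ShortCycles.
Context {n : nat} {X : {set {set 'I_n}}}.

Definition triangle (i j k : 'I_n) : chain 'F_2 X 1 :=
  [ffun x : face X 1 => ((val x \subset [set i; j; k])%:R : 'F_2)].

Lemma F2_neq0 (a : 'F_2) : a != 0 -> a = 1.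
Proof. by case: a => -[|[|[]]] //= h _; apply/val_inj. Qed.

Context (vertexX : forall v : 'I_n, [set v] \in X).

(** The support of a cycle has no leaf: if [[set v; w]] were the only edge of the support at [v],
    the boundary at [v] would be its coefficient up to sign. *)
Lemma cycle_continues {K : nzRingType} (c : chain K X 1) (v w : 'I_n) :
  boundary c = 0 -> v != w -> extend c [set v; w] != 0 ->
  exists u, [/\ u != v, u != w & extend c [set v; u] != 0].
Proof.
move=> c0 vw cvw.
have [x xv] : exists x : face X 0, val x = [set v].
  by apply: face_exists; rewrite ?cards1.
have := congr1 (fun f : chain K X 0 => f x) c0; rewrite (boundary_vertex c x v xv) [RHS]ffunE.
rewrite (bigD1 w) 1?eq_sym//= => s0.
case: (pickP [pred u | [&& u != v, u != w & extend c [set v; u] != 0]]) => [u /and3P[]|none].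
  by exists u.
exfalso; move: s0; rewrite big1 ?addr0 => [/eqP|u /andP[uv uw]].
  by rewrite mulr_sign; case: ifP => _; rewrite ?oppr_eq0 (negPf cvw).
by have := none u; rewrite /= uv uw /= => /negbFE/eqP ->; rewrite mulr0.
Qed.

(** Starting from one edge, the cycle is continued at both ends. With only three edges available the
    two continuations must meet, and they close up a triangle. *)
Lemma short_cycle (tau : chain 'F_2 X 1) : boundary tau = 0 -> card_supp tau = 3%N ->
  exists i j k : 'I_n, [/\ (i < j)%N, (j < k)%N & tau = triangle i j k].
Proof.
move=> tau0 tau3; pose S : {set {set 'I_n}} := [set val x | x in [set x : face X 1 | tau x != 0]].
have S3 : #|S| = 3%N by rewrite card_imset //; exact: val_inj.
have Sx (x : face X 1) : (val x \in S) = (tau x != 0).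
  by rewrite (mem_imset _ _ val_inj) inE.
have extS s : (s \in S) = (extend tau s != 0).
  apply/imsetP/idP => [[x]|].
    by rewrite inE => h ->; rewrite extend_val.
  apply: contraNP => h; rewrite /extend big1 // => x /eqP xs.
  by apply/eqP; apply: contrapT => /negP h'; apply: h; exists x; rewrite ?inE.
have cont v w : v != w -> [set v; w] \in S ->
    exists u, [/\ u != v, u != w & [set v; u] \in S].
  by move=> vw; rewrite extS => /(cycle_continues _ _ _ tau0 vw)[u [? ? ?]]; exists u; rewrite extS.
have ne (a b c d : 'I_n) : a != c -> a != d -> [set a; b] != [set c; d].
  move=> ac ad; apply/eqP => /setP /(_ a); rewrite !inE eqxx /=.
  by rewrite (negPf ac) (negPf ad).
have four (l : seq {set 'I_n}) : uniq l -> {subset l <= S} -> (size l <= 3)%N.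
  by move=> ul lS; rewrite -S3 cardE uniq_leq_size // => s /lS; rewrite mem_enum.
have card2S s : s \in S -> #|s| = 2%N.
  by case/imsetP => x _ ->; have [] := face_valP _ x.
have [e eS] : exists e, e \in S by apply/card_gt0P; rewrite S3.
have /eqP/cards2P[v [w [vw eE]]] := card2S _ eS; subst e.
have wvS : [set w; v] \in S by rewrite finset.setUC.
have wv : w != v by rewrite eq_sym.
have [u [uv uw vuS]] := cont _ _ vw eS.
have [y [yw yv wyS]] := cont _ _ wv wvS.
have uvS : [set u; v] \in S by rewrite finset.setUC.
have vu : v != u by rewrite eq_sym.
have wu : w != u by rewrite eq_sym.
(* Otherwise the path y, w, v, u continues beyond [u] along a fourth edge. *)
have yu : y = u.
  apply/eqP; apply: contraT => yu; have uy : u != y by rewrite eq_sym.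
  have [z [zu zv uzS]] := cont _ _ uv uvS.
  have := four [:: [set v; w]; [set v; u]; [set w; y]; [set u; z]].
  rewrite /= !inE !negb_or; apply.
    rewrite !andbT; apply/and3P; split; [apply/and3P; split|apply/andP; split|].
    - by rewrite finset.setUC ne.
    - by rewrite ne // eq_sym.
    - by rewrite ne // eq_sym.
    - by rewrite ne // eq_sym.
    - by rewrite ne // eq_sym.
    - by rewrite eq_sym ne.
  by move=> s; rewrite !inE => /or4P[]/eqP->.
subst y; pose T : {set 'I_n} := [set v; w; u].
(* The three sides of [T] already exhaust [S], so an edge leaving [T] would be a fourth one. *)
have ST (s : {set 'I_n}) : s \in S -> s \subset T.
  move=> sS; apply: contraT => sT.
  have := four [:: s; [set v; w]; [set v; u]; [set w; u]].
  rewrite /= !inE !negb_or; apply.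
    rewrite !andbT; apply/and3P; split; [apply/and3P; split|apply/andP; split|].
    - by apply: contraNneq sT => ->; apply/fintype.subsetP => a; rewrite !inE => /orP[]->; rewrite ?orbT.
    - by apply: contraNneq sT => ->; apply/fintype.subsetP => a; rewrite !inE => /orP[]->; rewrite ?orbT.
    - by apply: contraNneq sT => ->; apply/fintype.subsetP => a; rewrite !inE => /orP[]->; rewrite ?orbT.
    - by rewrite finset.setUC ne.
    - by rewrite ne.
    - by rewrite ne.
  by move=> a; rewrite !inE => /or4P[]/eqP->.
have TS (s : {set 'I_n}) : #|s| = 2%N -> s \subset T -> s \in S.
  move=> /eqP/cards2P[a [b [ab ->]]] /fintype.subsetP sT.
  have := sT a; have := sT b; rewrite !inE !eqxx orbT /= => /(_ isT) hb /(_ isT) ha.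
  have wuS : [set u; w] \in S by rewrite finset.setUC.
  move: ab; case/orP: ha => [/orP[]|] /eqP->; case/orP: hb => [/orP[]|] /eqP->; by rewrite ?eqxx.
have [i [j [k [ij jk TE]]]] : exists i j k : 'I_n, [/\ (i < j)%N, (j < k)%N & T = [set i; j; k]].
  by apply: card3_increasing; rewrite /T -finset.setUA !cardsU1 cards1 !inE negb_or vw vu wu.
exists i, j, k; split=> //; apply/ffunP => x; rewrite ffunE -TE.
have [xS|xS] := boolP (val x \in S).
  by rewrite (ST _ xS); apply: F2_neq0; rewrite -Sx.
have -> : val x \subset T = false by apply: contraNF xS; apply: TS; have [] := face_valP _ x.
by apply/eqP; rewrite -[_ == _]negbK -Sx.
Qed.
End ShortCycles.

(** * Filling the image of a triangle by an affine simplex *)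

Section AffineFillings.
Context {R : realType} {H : completeNormedModType R} {n : nat} {X : {set {set 'I_n}}}.
Context (phi : 'rV[R]_n -> H).

Definition vertex_image (v : 'I_n) : H := phi (delta_mx 0 v).

(** [inord] sends an out-of-range position to 0. The condition on the other vertices therefore asks
    for positions in range as well as different from [m]. *)
Lemma parametrization_vertex (k : nat) (s : {set 'I_n}) (v : 'I_n) (m : 'I_k.+1) :
  v \in s -> position s v = m ->
  (forall w, w \in s -> w != v -> (position s w < k.+1)%N && (position s w != m)) ->
  parametrization s (delta_mx 0 m : 'rV[R]_k.+1) = delta_mx 0 v.
Proof.
move=> vs pv pw; apply/rowP => w; rewrite !mxE eqxx /=.
have [->|wv] /= := eqVneq w v.
  by rewrite vs pv inord_val !eqxx.
case: ifP => // ws; have /andP[wk wm] := pw _ ws wv.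
by rewrite -[inord _ == m]val_eqE /= inordK // (negPf wm).
Qed.

Lemma image_vertexE (f : face X 2) (i j k : 'I_n) :
  (i < j)%N -> (j < k)%N -> val f = [set i; j; k] ->
  [/\ image_vertex phi f 0 = vertex_image i, image_vertex phi f 1 = vertex_image j
    & image_vertex phi f 2 = vertex_image k].
Proof.
move=> ij jk fE; rewrite /image_vertex fE /vertex_image.
have [pi pj pk] := position3 _ _ _ ij jk.
have V (v : 'I_n) (m : 'I_3) : v \in [set i; j; k] -> position [set i; j; k] v = m ->
    parametrization [set i; j; k] (delta_mx 0 m : 'rV[R]_3) = delta_mx 0 v.
  move=> vs pv; apply: parametrization_vertex => // w.
  move: vs pv; rewrite !inE => /orP[/orP[]|]/eqP ->; rewrite ?pi ?pj ?pk => <-;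
  by move=> /orP[/orP[]|]/eqP ->; rewrite ?eqxx ?pi ?pj ?pk.
by split; congr phi; apply: V; rewrite ?pi ?pj ?pk ?inE ?eqxx ?orbT.
Qed.

Definition affine_edge (p q : H) : singular 1 :=
  fun t : std_simplex R 1 => val t 0 0 *: p + val t 0 1 *: q.

Lemma affine_on_edge (i j : 'I_n) : affine_on X phi -> [set i; j] \in X -> (i < j)%N ->
  (fun t : std_simplex R 1 => phi (parametrization [set i; j] (val t)))
  = affine_edge (vertex_image i) (vertex_image j).
Proof.
move=> aff ijX ij; apply/funext => t; rewrite /affine_edge.
move: (val t) (valP t) => {}t /andP[/forallP t0 /eqP t1].
have ij' : i != j by rewrite neq_ltn ij.
have t1E : t 0 0 = 1 - t 0 1.
  rewrite -t1 !big_ord_recl big_ord0 addr0 (_ : fintype.lift _ _ = 1) ?addrK //.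
  exact/val_inj.
have -> : parametrization [set i; j] t = (1 - t 0 1) *: delta_mx 0 i + t 0 1 *: delta_mx 0 j.
  apply/rowP => v; rewrite !mxE !inE eqxx /=.
  have [->|vi] /= := eqVneq v i.
    rewrite position2l // (negPf ij') mulr0 addr0 mulr1 -t1E; congr (t _ _).
    by apply/val_inj; rewrite /= inordK.
  have [->|vj] /= := eqVneq v j; last by rewrite !mulr0 addr0.
  rewrite position2r // mulr0 add0r mulr1; congr (t _ _).
  by apply/val_inj; rewrite /= inordK.
have vertex_closed v : v \in [set i; j] -> closed_simplex [set i; j] (delta_mx 0 v : 'rV[R]_n).
  move=> vij; split=> [w||w wij]; rewrite ?mxE ?eqxx /=.
  - exact: ler0n.
  - by rewrite (bigD1 v) //= mxE !eqxx big1 ?addr0 // => w /negPf wv; rewrite mxE wv.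
  - by case: eqVneq => // wv; move: wij; rewrite wv vij.
rewrite (aff _ ijX) ?t1E //; try (by apply: vertex_closed; rewrite !inE eqxx ?orbT).
by rewrite t0 -subr_ge0 -t1E t0.
Qed.

(** Setting one barycentric coordinate to 0 drops the corresponding vertex and leaves the affine
    edge on the other two. Over ['F_2] no signs appear. *)
Lemma boundary_affine_simplex (p q r : H) :
  singular_boundary (<< (1 : 'F_2) *g affine_simplex p q r >> : singular_chain 2) =
  << affine_edge q r >> + << affine_edge p r >> + << affine_edge p q >>.
Proof.
have row_lift (l : 'I_3) (m : 'I_2) (a : 'I_3) (t : 'rV[R]_2) :
    a = fintype.lift l m -> face_row l t 0 a = t 0 m.
  by move=> ->; rewrite mxE liftK.
have row_drop (l : 'I_3) (t : 'rV[R]_2) : face_row l t 0 l = 0.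
  by rewrite mxE unlift_none.
(* Here [w] is the vertex opposite to face [l], and [u], [v] are the remaining vertices, at the
   indices [a] and [b]. *)
have edge (l : 'I_3) (a b : 'I_3) (u v w : H) :
    a = fintype.lift l 0 -> b = fintype.lift l 1 ->
    (forall t : 'rV[R]_3, t 0 0 *: p + t 0 1 *: q + t 0 2 *: r =
      t 0 l *: w + (t 0 a *: u + t 0 b *: v)) ->
    (fun t => affine_simplex p q r (face_incl l t)) = affine_edge u v.
  move=> al bl E; apply/funext => t; rewrite /affine_simplex E /= row_drop.
  by rewrite (row_lift _ _ _ _ al) (row_lift _ _ _ _ bl) scale0r add0r.
rewrite /singular_boundary domU1 big_seq1 coeffU eqxx mulr1 !big_ord_recl big_ord0 addr0 addrA.
congr (<< _ >> + << _ >> + << _ >>).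
- apply: (edge _ 1 2 _ _ p); try exact/val_inj.
  by move=> t; rewrite addrA.
- apply: (edge _ 0 2 _ _ q); try exact/val_inj.
  move=> t; rewrite addrA; congr (_ + _); rewrite addrC; congr (_ + _); congr (t 0 _ *: _); exact/val_inj.
- apply: (edge _ 0 1 _ _ r); try exact/val_inj.
  move=> t; rewrite addrC; congr (_ + _); congr (t 0 _ *: _); exact/val_inj.
Qed.

Lemma image_triangle (i j k : 'I_n) : affine_on X phi -> complete_1skeleton X ->
  (i < j)%N -> (j < k)%N ->
  image_chain phi (triangle i j k : chain 'F_2 X 1) =
  << affine_edge (vertex_image j) (vertex_image k) >> +
  << affine_edge (vertex_image i) (vertex_image k) >> +
  << affine_edge (vertex_image i) (vertex_image j) >> :> singular_chain 1.
Proof.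
move=> aff completeX ij jk; have ik := ltn_trans ij jk.
have edge (a b : 'I_n) : (a < b)%N -> exists2 x : face X 1, val x = [set a; b] &
   (fun t : std_simplex R 1 => phi (parametrization (val x) (val t)))
  = affine_edge (vertex_image a) (vertex_image b).
  move=> ab; have abX : [set a; b] \in X by apply: completeX; rewrite neq_ltn ab.
  have [||x xE] := @face_exists _ X 1 [set a; b]; rewrite ?cards2 ?neq_ltn ?ab //.
  by exists x => //; rewrite xE affine_on_edge.
have [x1 x1E e1] := edge _ _ jk; have [x2 x2E e2] := edge _ _ ik.
have [x3 x3E e3] := edge _ _ ij.
have ij' : i != j by rewrite neq_ltn ij.
have jk' : j != k by rewrite neq_ltn jk.
have ik' : i != k by rewrite neq_ltn ik.
have ne (x y : face X 1) (a : 'I_n) : a \in val x -> a \notin val y -> y != x.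
  by move=> ax; apply: contraNneq => ->.
have x21 : x2 != x1.
  by apply: (ne _ _ j); rewrite ?x1E ?x2E !inE ?eqxx // negb_or jk' eq_sym ij'.
have x31 : x3 != x1.
  by apply: (ne _ _ k); rewrite ?x1E ?x3E !inE ?eqxx ?orbT // negb_or eq_sym ik' eq_sym jk'.
have x32 : x3 != x2.
  by apply: (ne _ _ k); rewrite ?x2E ?x3E !inE ?eqxx ?orbT // negb_or eq_sym ik' eq_sym jk'.
rewrite /image_chain (bigD1 x1) //= (bigD1 x2) //= (bigD1 x3) ?x31 //= !ffunE.
rewrite e1 e2 e3 big1 => [|x /andP[/andP[xx1 xx2] xx3]].
  rewrite addr0 addrA x1E x2E x3E.
  have -> : [set j; k] \subset [set i; j; k].
    by apply/fintype.subsetP => a; rewrite !inE => /orP[]->; rewrite ?orbT.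
  have -> : [set i; k] \subset [set i; j; k].
    by apply/fintype.subsetP => a; rewrite !inE => /orP[]->; rewrite ?orbT.
  have -> : [set i; j] \subset [set i; j; k] by rewrite finset.subsetUl.
  by [].
rewrite ffunE; have [xT|_] := boolP (val x \subset [set i; j; k]); last by rewrite freegU0.
(* An edge inside [[set i; j; k]] is one of the three sides, all of which have been split off. *)
exfalso; have [a [b [ab xE]]] := card2_increasing _ (face_valP _ x).2.
move: xT; rewrite xE => /fintype.subsetP T.
have := T a; have := T b; rewrite !inE !eqxx orbT /= => /(_ isT) hb /(_ isT) ha.
have no (y : face X 1) (c d : 'I_n) : val y = [set c; d] -> x != y -> (a == c) && (b == d) = false.
  move=> yE; apply: contraNF => /andP[/eqP ac /eqP bd].
  by apply/eqP/val_inj; rewrite /= yE -ac -bd; exact: xE.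
have n1 := no _ _ _ x1E xx1; have n2 := no _ _ _ x2E xx2; have n3 := no _ _ _ x3E xx3.
move: ha hb ab n1 n2 n3; clear - ij jk ik.
by move=> /orP[/orP[]|] /eqP-> /orP[/orP[]|] /eqP->; rewrite ?ltnn ?eqxx // ltnNge ltnW.
Qed.

(** The affine simplex on the three image points is a Lipschitz chain with the required boundary,
    hence a competitor in the infimum. *)
Lemma fill_triangle_le (dot : {dot H for idfun}) (i j k : 'I_n) :
  affine_on X phi -> complete_1skeleton X -> (i < j)%N -> (j < k)%N ->
  (fill_lipschitz dot (image_chain phi (triangle i j k : chain 'F_2 X 1)) <=
   (triangle_area dot (vertex_image i) (vertex_image j) (vertex_image k))%:E)%E.
Proof.
move=> aff completeX ij jk.
pose y : singular_chain 2 :=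
  << (1 : 'F_2) *g affine_simplex (vertex_image i) (vertex_image j) (vertex_image k) >>.
apply: (@le_trans _ _ (vol2 dot y)); last first.
  by rewrite /vol2 domU1 big_seq1 singular_area_affine.
apply: ereal_inf_lbound; exists y => //; split.
  by move=> s; rewrite domU1 inE => /eqP ->; exact: lipschitz_affine_simplex.
by rewrite boundary_affine_simplex image_triangle.
Qed.
End AffineFillings.

(** * Gram-Schmidt coordinates and the area of a triangle as the norm of a bivector *)

Section GramCoordinates.
Context {R : realType} {H : completeNormedModType R} (dot : {dot H for idfun}).

Lemma dotC (u v : H) : dot u v = dot v u.
Proof. by rewrite hermitian_subproof expr0 mul1r. Qed.

Lemma dotBl (u v w : H) : dot (u - v) w = dot u w - dot v w.
Proof. exact: linearBl. Qed.

Lemma dotBr (u v w : H) : dot w (u - v) = dot w u - dot w v.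
Proof. by rewrite dotC dotBl !(dotC w). Qed.

Lemma dotZl (a : R) (u w : H) : dot (a *: u) w = a * dot u w.
Proof. exact: linearZl_LR. Qed.

Lemma dotZr (a : R) (u w : H) : dot w (a *: u) = a * dot w u.
Proof. by rewrite dotC dotZl (dotC w). Qed.

Lemma dot_eq0 (u : H) : dot u u = 0 -> u = 0.
Proof.
move=> h; apply/eqP; apply: contra_eqT h => u0.
by rewrite gt_eqF // neq0_dnorm_gt0.
Qed.

Lemma dot_ge0 (u : H) : 0 <= dot u u.
Proof.
have [->|u0] := eqVneq u 0; last by rewrite ltW // neq0_dnorm_gt0.
by rewrite -[X in dot X _](scale0r (0 : H)) dotZl mul0r.
Qed.

(* Gram-Schmidt, projecting away the last vector [u]; if [u = 0] then
   [x / 0 = 0] makes the projection trivial. *)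
Lemma gram_coordinates (m : nat) (p : nat -> H) : exists x : nat -> nat -> R,
  forall i j, (i < m)%N -> (j < m)%N -> dot (p i) (p j) = \sum_(a < m) x i a * x j a.
Proof.
elim: m p => [|m IH] p; first by exists (fun _ _ => 0).
pose u := p m; pose c := dot u u.
have u0 v : c = 0 -> dot v u = 0.
  by move=> /dot_eq0 ->; rewrite -[X in dot _ X](scale0r (0 : H)) dotZr mul0r.
have [x xP] := IH (fun i => p i - (dot (p i) u / c) *: u).
pose s := Num.sqrt c; have ss : s * s = c by rewrite -expr2 sqr_sqrtr // dot_ge0.
(* Coordinate [m] is the component along the unit vector [u / s]; the others come from the
   projections orthogonal to [u] and vanish for [u] itself. *)
exists (fun i a => if a == m then dot (p i) u / s else if i == m then 0 else x i a).
have sum_last i j : \sum_(a < m.+1)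
    (if a == m :> nat then dot (p i) u / s else if i == m then 0 else x i a) *
    (if a == m :> nat then dot (p j) u / s else if j == m then 0 else x j a) =
    \sum_(a < m) (if i == m then 0 else x i a) * (if j == m then 0 else x j a)
      + dot (p i) u * dot (p j) u / c.
  rewrite big_ord_recr /= eqxx; congr (_ + _).
    by apply: eq_bigr => a _; rewrite ltn_eqF.
  by rewrite mulrACA -invfM ss.
(* If [c = 0] then [u = 0], and both sides are 0. *)
have last v : dot v u = dot v u * dot u u / c.
  have [c0|c0] := eqVneq c 0; first by rewrite u0 // !mul0r.
  by rewrite -/c mulfK.
move=> i j; rewrite !ltnS sum_last => im jm.
have [->|im'] := eqVneq i m.
  by rewrite big1 ?add0r => [|a _]; rewrite ?mul0r // -/u [LHS]dotC [LHS]last [X in X / c = _]mulrC.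
have [->|jm'] := eqVneq j m.
  by rewrite big1 ?add0r => [|a _]; rewrite ?mulr0 // -/u [LHS]last.
rewrite -xP ?ltn_neqAle ?im' ?jm' //.
rewrite !(dotBl, dotBr, dotZl, dotZr) -/c.
rewrite (dotC u).
have [c0|c0] := eqVneq c 0.
  by rewrite !u0 // !(mul0r, mulr0, subr0, addr0).
by field.
Qed.

(** The double sum counts each unordered pair of indices twice, whence the factor 1/2. *)
Lemma lagrange_identity (m : nat) (u v : 'I_m -> R) :
  (\sum_a u a * u a) * (\sum_a v a * v a) - (\sum_a u a * v a) ^+ 2 =
  2^-1 * \sum_a \sum_b (u a * v b - u b * v a) ^+ 2.
Proof.
have -> : \sum_a \sum_b (u a * v b - u b * v a) ^+ 2 =
  \sum_a \sum_b (u a * u a) * (v b * v b) + \sum_a \sum_b (u b * u b) * (v a * v a)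
  - 2 * \sum_a \sum_b (u a * v a) * (u b * v b).
  rewrite mulr_sumr -big_split -sumrB /=; apply: eq_bigr => a _.
  rewrite mulr_sumr -big_split -sumrB /=; apply: eq_bigr => b _; ring.
rewrite [X in _ + X - _]exchange_big /=.
have D (f g : 'I_m -> R) : \sum_a \sum_b f a * g b = (\sum_a f a) * (\sum_b g b).
  by rewrite big_distrlr.
rewrite (D (fun a => u a * u a) (fun b => v b * v b)) (D (fun a => u a * v a) (fun b => u b * v b)).
by field.
Qed.

(** The bivector (p1 - p0) /\ (p2 - p0) expands to p1 /\ p2 - p0 /\ p2 + p0 /\ p1, a coboundary. The
    constant 1/8 is 1/4 from halving the parallelogram times 1/2 from [lagrange_identity]. *)
Lemma triangle_area_sqr (m : nat) (p : 'I_3 -> H) (x : 'I_3 -> 'I_m -> R) :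
  (forall i j, dot (p i) (p j) = \sum_a x i a * x j a) ->
  triangle_area dot (p 0) (p 1) (p 2) ^+ 2 = 8^-1 * \sum_a \sum_b
    ((x 1 a * x 2 b - x 1 b * x 2 a) - (x 0 a * x 2 b - x 0 b * x 2 a)
      + (x 0 a * x 1 b - x 0 b * x 1 a)) ^+ 2.
Proof.
move=> xP.
have dotE (i j k l : 'I_3) : dot (p i - p j) (p k - p l) =
    \sum_a (x i a - x j a) * (x k a - x l a).
  rewrite !(dotBl, dotBr) !xP -!sumrB; apply: eq_bigr => a _; ring.
rewrite /triangle_area /parallelogram_area exprMn !dotE lagrange_identity sqr_sqrtr.
  rewrite mulrAC; congr (_ * _); first by field.
  by apply: eq_bigr => a _; apply: eq_bigr => b _; congr (_ ^+ 2); ring.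
rewrite mulr_ge0 // sumr_ge0 // => a _; rewrite sumr_ge0 // => b _; exact: sqr_ge0.
Qed.
End GramCoordinates.

(** * The spectral gap and sums over all triangles *)

Section Gap.
Context {R : realType} {n : nat} {X : {set {set 'I_n}}}.

Lemma cochain_norm_sqr k (b : chain R X k) : cochain_norm b ^+ 2 = \sum_x b x ^+ 2.
Proof.
rewrite sqr_sqrtr; last by apply: sumr_ge0 => x _; exact: sqr_ge0.
by apply: eq_bigr => x _; rewrite real_normK // num_real.
Qed.

Lemma spectral_gap1_ge0 : (0 <= spectral_gap1 R X)%E.
Proof.
by apply: le_ereal_inf_tmp => _ [b _ <-]; rewrite lee_fin divr_ge0 // sqr_ge0.
Qed.

Lemma spectral_gap1_le (b : chain R X 1) : boundary b = 0 ->
  (spectral_gap1 R X * (\sum_x b x ^+ 2)%:E <= (\sum_y coboundary b y ^+ 2)%:E)%E.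
Proof.
move=> b0; rewrite -!cochain_norm_sqr.
(* The zero cochain is excluded from the infimum. The gap may then be [+oo], but its product with 0
   is 0. *)
have [->|bn0] := eqVneq b 0.
  rewrite !cochain_norm_sqr [X in (_ * X)%E](_ : _ = 0%E); last first.
    by congr (_%:E); apply: big1 => x _; rewrite ffunE expr0n.
  by rewrite mule0 lee_fin sumr_ge0 // => y _; exact: sqr_ge0.
have nb0 : 0 < cochain_norm b ^+ 2.
  rewrite lt_def sqr_ge0 andbT cochain_norm_sqr psumr_eq0 => [|x _]; last exact: sqr_ge0.
  apply: contraNN bn0 => /allP h; apply/eqP/ffunP => x; rewrite ffunE.
  by have := h x (mem_index_enum _); rewrite /= sqrf_eq0 => /eqP.
rewrite -lee_pdivlMr // ; apply: ereal_inf_lbound; exists b => //.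
Qed.

Context (completeX : complete_1skeleton X).

(** Exactly one pair contributes: the endpoints of [e] in increasing order, in agreement with the
    chosen orientation of edges. *)
Definition cochain_of (B : 'I_n -> 'I_n -> R) : chain R X 1 :=
  [ffun e : face X 1 =>
     \sum_(p : 'I_n * 'I_n | (p.1 < p.2)%N && (val e == [set p.1; p.2])) B p.1 p.2].

Lemma ordered_pair_inj (i j k l : 'I_n) : (i < j)%N -> (k < l)%N ->
  ([set i; j] == [set k; l]) = ((k, l) == (i, j)).
Proof.
move=> ij kl; apply/eqP/eqP => [/setP E|[-> ->]//].
have := E k; have := E l; have := E i; rewrite !inE !eqxx ?orbT /=.
by move=> /esym/orP[]/eqP ? /orP[]/eqP ? /orP[]/eqP ?; subst; rewrite ?ltnn // in ij kl *;
   move: (ltn_trans ij kl); rewrite ltnn.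
Qed.

Lemma edge_exists (i j : 'I_n) : (i < j)%N -> exists e : face X 1, val e = [set i; j].
Proof.
move=> ij; apply: face_exists; last by rewrite cards2 neq_ltn ij.
by apply: completeX; rewrite neq_ltn ij.
Qed.

Lemma cochain_ofE (B : 'I_n -> 'I_n -> R) (i j : 'I_n) (e : face X 1) : (i < j)%N ->
  val e = [set i; j] -> cochain_of B e = B i j.
Proof.
move=> ij eE; rewrite ffunE (big_pred1 (i, j)) // => -[k l] /=; rewrite eE.
case: ltnP => [kl|lk] /=; first by rewrite ordered_pair_inj.
by apply/esym/negP => /eqP[ki lj]; subst; move: lk; rewrite leqNgt ij.
Qed.

Lemma extend_cochain_of (B : 'I_n -> 'I_n -> R) (i j : 'I_n) : (i < j)%N ->
  extend (cochain_of B) [set i; j] = B i j.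
Proof.
move=> ij; have [e eE] := edge_exists _ _ ij.
by rewrite -eE extend_val (cochain_ofE _ _ _ _ ij).
Qed.

(** Skew-symmetry absorbs the orientation signs, so the boundary at [v] is the column sum of [B i v]
    over all [i]. *)
Lemma boundary_cochain_of (B : 'I_n -> 'I_n -> R) : (forall i j, B i j = - B j i) ->
  (forall j, \sum_i B i j = 0) -> boundary (cochain_of B) = 0.
Proof.
move=> skewB B0; apply/ffunP => x; rewrite [RHS]ffunE.
have [_ /eqP/cards1P[v xv]] := face_valP _ x.
have Bvv : B v v = 0 by have := skewB v v; lra.
rewrite (boundary_vertex _ _ _ xv); transitivity (\sum_i B i v); last exact: B0.
rewrite [RHS](bigD1 v) //= Bvv add0r.
apply: eq_bigr => w; rewrite neq_ltn => /orP[] h.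
  by rewrite ltnNge ltnW //= mul1r finset.setUC extend_cochain_of.
by rewrite h extend_cochain_of // expr1 mulN1r -skewB.
Qed.

Lemma coboundary_cochain_of (B : 'I_n -> 'I_n -> R) (y : face X 2) (i j k : 'I_n) :
  (i < j)%N -> (j < k)%N -> val y = [set i; j; k] ->
  coboundary (cochain_of B) y = B j k - B i k + B i j.
Proof.
move=> ij jk yE; rewrite (coboundary_triangle _ _ _ _ _ ij jk yE).
by rewrite !extend_cochain_of // (ltn_trans ij jk).
Qed.

(** Since the 1-skeleton is complete, edges correspond bijectively to increasing pairs. *)
Lemma sum_sqr_cochain_of (B : 'I_n -> 'I_n -> R) :
  \sum_x cochain_of B x ^+ 2 = \sum_(p : 'I_n * 'I_n | (p.1 < p.2)%N) B p.1 p.2 ^+ 2.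
Proof.
transitivity (\sum_(x : face X 1) \sum_(p : 'I_n * 'I_n |
    (p.1 < p.2)%N && (val x == [set p.1; p.2])) B p.1 p.2 ^+ 2).
  apply: eq_bigr => x _; have [i [j [ij xE]]] := card2_increasing _ (face_valP _ x).2.
  rewrite (cochain_ofE _ _ _ _ ij xE).
  have := cochain_ofE (fun i j => B i j ^+ 2) _ _ _ ij xE.
  by rewrite ffunE => ->.
rewrite (exchange_big_dep (fun p : 'I_n * 'I_n => (p.1 < p.2)%N)) /=; last first.
  by move=> x p _ /andP[].
apply: eq_bigr => -[i j] /= ij; have [e eE] := edge_exists _ _ ij.
by rewrite (big_pred1 e) // => x /=; rewrite ij -eE.
Qed.

Definition increasing (t : 'I_n * 'I_n * 'I_n) : bool := (t.1.1 < t.1.2 < t.2)%N.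

(** Double counting: each edge has [n - 2] choices of a third vertex. *)
Lemma sum_triangle_edges (F : 'I_n -> 'I_n -> R) :
  \sum_(t | increasing t) (F t.1.2 t.2 + F t.1.1 t.2 + F t.1.1 t.1.2) =
  (n%:R - 2) * \sum_(p : 'I_n * 'I_n | (p.1 < p.2)%N) F p.1 p.2.
Proof.
have nest (G : 'I_n -> 'I_n -> 'I_n -> R) : \sum_(t | increasing t) G t.1.1 t.1.2 t.2 =
    \sum_(a < n) \sum_(b < n) \sum_(c < n) if (a < b < c)%N then G a b c else 0.
  rewrite pair_bigA /=.
  rewrite (pair_bigA _ (fun (p : 'I_n * 'I_n) (c : 'I_n) =>
    if (p.1 < p.2 < c)%N then G p.1 p.2 c else 0)).
  by rewrite [LHS]big_mkcond.
(* The third vertex [c] lies below, between or above the endpoints; only [c = i] and [c = j]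
   contribute 0. *)
have count (i j : 'I_n) : (i < j)%N -> \sum_(c < n)
    ((c < i)%N%:R + (i < c < j)%N%:R + (j < c)%N%:R) = n%:R - 2 :> R.
  move=> ij; have ij' : j != i by rewrite neq_ltn ij orbT.
  have -> : n%:R = \sum_(c < n) 1 :> R by rewrite sumr_const card_ord.
  rewrite (bigD1 i) // [in RHS](bigD1 i) //= (bigD1 j) //= [in RHS](bigD1 j) //=.
  rewrite !ltnn ij [(j < i)%N]ltnNge ltnW //= ?andbF /=.
  set S := (X in _ + (_ + X)); set S' := (X in 1 + (1 + X) - 2).
  have -> : S = S'; last ring.
  apply: eq_bigr => c /andP[]; rewrite !neq_ltn => ci cj.
  case: (ltngtP c i) ci => //= ci _; case: (ltngtP c j) cj => //= cj _; rewrite ?addr0 ?add0r //.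
  by have := ltn_trans (ltn_trans cj ci) ij; rewrite ltnn.
rewrite !big_split /= (nest (fun _ b c => F b c)) (nest (fun a _ c => F a c)).
rewrite (nest (fun a b _ => F a b)) mulr_sumr [RHS]big_mkcond /=.
rewrite -(pair_bigA _ (fun i j : 'I_n => if (i < j)%N then (n%:R - 2) * F i j else 0)) /=.
(* The sums are reordered so that in all three terms [i] and [j] are the endpoints of the edge and
   the innermost index is the third vertex. *)
rewrite [X in X + _ + _]exchange_big /= -!big_split /=; apply: eq_bigr => i _.
rewrite [X in X + _ + _]exchange_big /= [X in _ + X + _]exchange_big /= -!big_split /=.
apply: eq_bigr => j _; rewrite -!big_split /=.
case: ifPn => [ij|ij].
  rewrite -(count _ _ ij) mulr_suml; apply: eq_bigr => c _.
  by rewrite andbT /= !mulrDl; do 3!case: ifP => _; rewrite ?mul1r ?mul0r.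
rewrite big1 // => c _; rewrite andbF /= addr0 add0r.
by case: ifP => // /andP[/ltn_trans h /h]; rewrite (negPf ij).
Qed.

Lemma sum_sqr_triangles (B : 'I_n -> 'I_n -> R) :
  \sum_(t | increasing t) (B t.1.2 t.2 - B t.1.1 t.2 + B t.1.1 t.1.2) ^+ 2 <=
  3 * (n%:R - 2) * \sum_(p : 'I_n * 'I_n | (p.1 < p.2)%N) B p.1 p.2 ^+ 2.
Proof.
rewrite -mulrA -(sum_triangle_edges (fun i j => B i j ^+ 2)) mulr_sumr.
apply: ler_sum => t _ /=.
move: (B t.1.2 t.2) (B t.1.1 t.2) (B t.1.1 t.1.2) => x y z.
(* 3 (x^2 + y^2 + z^2) - (x - y + z)^2 = (x + y)^2 + (y + z)^2 + (x - z)^2 *)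
by have := sqr_ge0 (x + y); have := sqr_ge0 (y + z); have := sqr_ge0 (x - z); nra.
Qed.

(* Subtracting the coboundary of [j |-> (\sum_i B i j) / n] makes [B]
   coclosed and does not change its coboundary. *)
Lemma spectral_gap1_triangles (B : 'I_n -> 'I_n -> R) : (2 < n)%N ->
  (forall i j, B i j = - B j i) ->
  (spectral_gap1 R X *
    (\sum_(t | increasing t) (B t.1.2 t.2 - B t.1.1 t.2 + B t.1.1 t.1.2) ^+ 2)%:E <=
   (3 * (n%:R - 2) * \sum_(y : face X 2) coboundary (cochain_of B) y ^+ 2)%:E)%E.
Proof.
move=> n2 skewB; have nR : n%:R != 0 :> R by rewrite pnatr_eq0; lia.
have n2R : 0 <= n%:R - 2 :> R by rewrite subr_ge0 ler_nat ltnW.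
pose g j := (\sum_i B i j) / n%:R; pose B' i j := B i j - (g j - g i).
have skewB' i j : B' i j = - B' j i by rewrite /B' (skewB i j); ring.
(* By skew-symmetry the total sum of [B] equals its own negative. A column sum of [B'] is then the
   column sum of [B] minus [n] times [g j], which is 0. *)
have sumg : \sum_i g i = 0.
  rewrite -mulr_suml [X in X / _](_ : _ = 0) ?mul0r //.
  have : \sum_j \sum_i B i j = - \sum_j \sum_i B i j.
    rewrite {1}exchange_big /= -sumrN; apply: eq_bigr => j _.
    by rewrite -sumrN; apply: eq_bigr => i _.
  by move=> h; lra.
have B'0 j : \sum_i B' i j = 0.
  rewrite /B' !sumrB sumg sumr_const card_ord subr0 -mulr_natr /g divfK //.
  by rewrite subrr.
rewrite (eq_bigr (fun t : 'I_n * 'I_n * 'I_n =>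
  (B' t.1.2 t.2 - B' t.1.1 t.2 + B' t.1.1 t.1.2) ^+ 2)); last first.
  by move=> t _; rewrite /B'; congr (_ ^+ 2); ring.
have -> : \sum_(y : face X 2) coboundary (cochain_of B) y ^+ 2 =
          \sum_(y : face X 2) coboundary (cochain_of B') y ^+ 2.
  apply: eq_bigr => y _.
  have [i [j [k [ij jk yE]]]] := card3_increasing _ (face_valP _ y).2.
  by rewrite !(coboundary_cochain_of _ _ _ _ _ ij jk yE) /B'; congr (_ ^+ 2); ring.
apply: (@le_trans _ _ (spectral_gap1 R X * (3 * (n%:R - 2) *
     \sum_(p : 'I_n * 'I_n | (p.1 < p.2)%N) B' p.1 p.2 ^+ 2)%:E)%E).
  by apply: lee_wpmul2l; rewrite ?spectral_gap1_ge0 // lee_fin; exact: sum_sqr_triangles.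
rewrite -sum_sqr_cochain_of !EFinM -!EFinM [in leLHS]EFinM [in leRHS]EFinM muleCA.
apply: lee_wpmul2l; first by rewrite lee_fin mulr_ge0.
by apply: spectral_gap1_le; exact: boundary_cochain_of.
Qed.
End Gap.

(** * Comparison of fillings, areas of all triangles and areas of faces *)

Theorem proposition1p4 (R : realType) (H : completeNormedModType R)
    (dot : {dot H for idfun})
    (hilbert : forall u : H, `|u| ^+ 2 = dot u u)
    (n : nat) (X : {set {set 'I_n}})
    (complexX : simplicial_complex X)
    (dimX : dimension_is X 2)
    (completeX : complete_1skeleton X)
    (phi : 'rV[R]_n -> H)
    (affine_phi : affine_on X phi)
    (scaled : forall tau : chain 'F_2 X 1,
      boundary tau = 0 -> card_supp tau = 3%N ->
      (fill_simplicial R tau <= fill_lipschitz dot (image_chain phi tau))%E) :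
  (spectral_gap1 R X * ((3 * (n%:R - 2))^-1)%R%:E *
     \sum_(tau : chain 'F_2 X 1 | (boundary tau == 0%R) && (card_supp tau == 3%N))
        fill_simplicial R tau ^+ 2
   <= (\sum_(f : face X 2) image_area phi dot f ^+ 2)%R%:E)%E.
Proof.
have [vertexX _ _] := complexX.
have n2 : (2 < n)%N.
  have [_ [s _ s3]] := dimX.
  by rewrite -[n]card_ord -[X in (X <= _)%N]s3 max_card.
have n2R : 0 < n%:R - 2 :> R by rewrite subr_gt0 ltr_nat.
pose p := vertex_image phi.
(* [gram_coordinates] takes a family indexed by [nat], so [p] is extended by 0 beyond [n]. *)
have [x xP] := gram_coordinates dot n (fun m => oapp p 0 (insub m)).
have {}xP (i j : 'I_n) : dot (p i) (p j) = \sum_(a < n) x i a * x j a.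
  by rewrite -xP // !valK.
pose B (a b i j : 'I_n) : R := x i a * x j b - x i b * x j a.
have areaE (i j k : 'I_n) : triangle_area dot (p i) (p j) (p k) ^+ 2 =
    8^-1 * \sum_a \sum_b (B a b j k - B a b i k + B a b i j) ^+ 2.
  have := @triangle_area_sqr _ _ dot n (fun m : 'I_3 => p (nth i [:: i; j; k] m))
    (fun m a => x (nth i [:: i; j; k] m) a).
  by apply => l m; exact: xP.
(* [T] mediates between the two sides: it bounds the sum of squared fillings, and the gap bounds it
   by the faces. *)
pose T : R := \sum_(t | increasing t) triangle_area dot (p t.1.1) (p t.1.2) (p t.2) ^+ 2.
have fill_le : (\sum_(tau : chain 'F_2 X 1 | (boundary tau == 0%R) && (card_supp tau == 3%N))
    fill_simplicial R tau ^+ 2 <= T%:E)%E.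
  pose P (tau : chain 'F_2 X 1) := (boundary tau == 0) && (card_supp tau == 3%N).
  (* Each cycle is charged to the increasing triples that produce it. After exchanging the sums,
     each triple is charged by at most one cycle. *)
  apply: (@le_trans _ _ (\sum_(tau | P tau) \sum_(t | increasing t &&
      (tau == triangle t.1.1 t.1.2 t.2)) triangle_area dot (p t.1.1) (p t.1.2) (p t.2) ^+ 2)%:E).
    rewrite -sumEFin; apply: lee_sum => tau /andP[/eqP tau0 /eqP tau3].
    have [i [j [k [ij jk tauE]]]] := short_cycle vertexX tau tau0 tau3.
    rewrite (bigD1 (i, j, k)) /=; last by rewrite /increasing /= ij jk tauE eqxx.
    apply: (@le_trans _ _ (triangle_area dot (p i) (p j) (p k) ^+ 2)%:E); last first.
      by rewrite lee_fin lerDl sumr_ge0 // => t _; exact: sqr_ge0.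
    rewrite EFin_expe lee_sqr.
    - apply: le_trans (scaled _ tau0 tau3) _; rewrite tauE.
      exact: fill_triangle_le.
    - by apply: le_bigmin => [|y _]; rewrite ?leey // lee_fin.
    - by rewrite lee_fin divr_ge0 // sqrtr_ge0.
  rewrite lee_fin (exchange_big_dep increasing) /=; last by move=> tau t _ /andP[].
  apply: ler_sum => t tinc; rewrite big_mkcond (bigD1 (triangle t.1.1 t.1.2 t.2)) //=.
  rewrite big1 => [|tau /negPf tn]; last by rewrite tinc tn /= andbF.
  by rewrite addr0; case: ifP => // _; exact: sqr_ge0.
have gap_le : (spectral_gap1 R X * T%:E <=
    (3 * (n%:R - 2) * \sum_(f : face X 2) image_area phi dot f ^+ 2)%:E)%E.
  have -> : T = \sum_a \sum_b 8^-1 * \sum_(t | increasing t)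
      (B a b t.1.2 t.2 - B a b t.1.1 t.2 + B a b t.1.1 t.1.2) ^+ 2.
    rewrite pair_bigA /= -mulr_sumr exchange_big /= mulr_sumr; apply: eq_bigr => t _.
    by rewrite areaE pair_bigA.
  have -> : \sum_(f : face X 2) image_area phi dot f ^+ 2 = \sum_a \sum_b
      8^-1 * \sum_(f : face X 2) coboundary (cochain_of (X := X) (B a b)) f ^+ 2.
    rewrite [RHS]pair_bigA /= -mulr_sumr exchange_big /= mulr_sumr; apply: eq_bigr => f _.
    have [i [j [k [ij jk fE]]]] := card3_increasing _ (face_valP _ f).2.
    have [f0 f1 f2] := image_vertexE phi f _ _ _ ij jk fE.
    rewrite /image_area f0 f1 f2 areaE pair_bigA; congr (_ * _); apply: eq_bigr => ab _.
    by rewrite (coboundary_cochain_of completeX _ _ _ _ _ ij jk fE).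
  (* The gap, an extended real, is distributed over the components [B a b]; the terms are
     nonnegative, so this holds for an infinite gap too. *)
  rewrite !pair_bigA /= mulr_sumr -!sumEFin ge0_sume_distrr; last first.
    move=> ab _; rewrite lee_fin mulr_ge0 // sumr_ge0 // => t _; exact: sqr_ge0.
  apply: lee_sum => ab _; rewrite mulrCA EFinM muleCA [leRHS]EFinM.
  apply: lee_wpmul2l; first by rewrite lee_fin.
  apply: spectral_gap1_triangles => // i j; rewrite /B; ring.
have c_ge0 : 0 <= (3 * (n%:R - 2))^-1 :> R by rewrite invr_ge0 mulr_ge0 // ltW.
apply: (@le_trans _ _ (spectral_gap1 R X * ((3 * (n%:R - 2))^-1)%:E * T%:E)%E).
  by apply: lee_wpmul2l => //; rewrite mule_ge0 ?lee_fin ?spectral_gap1_ge0.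
rewrite [X in (X * _)%E]muleC -muleA.
apply: le_trans (lee_wpmul2l _ gap_le) _; first by rewrite lee_fin.
by rewrite -EFinM lee_fin mulrA mulVf ?mul1r // mulf_neq0 // gt_eqF.
Qed.
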